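(* The set $\mathrm{SD}_{\neg\mathrm{B}}=\{X\in\mathrm{SF}\mid X\text{ has a separable dual and is not normable}\}$ is $\Pi^1_1$-hard.
   Context: A Fréchet space is a completely metrizable locally convex topological vector space (real scalars) whose topology can be defined by an invariant metric. $C(\mathbb{R})$ is the Fréchet space of continuous real-valued functions on $\mathbb{R}$ with the topology of uniform convergence on compact sets. $\mathrm{SF}=\{X\subseteq C(\mathbb{R})\mid X\text{ is a closed vector subspace}\}$ with the Effros Borel structure, i.e., the $\sigma$-algebra generated by the sets $\{X\in\mathrm{SF}\mid X\cap U\neq\emptyset\}$, $U\subseteq C(\mathbb{R})$ open; it is a standard Borel space. $X\in\mathrm{SF}$ is normable if there is a norm on $X$ generating its topology. The dual $X^*$ of a Fréchet space $X$ is its topological dual with the strong topology (uniform convergence on bounded subsets of $X$). A subset $A$ of a standard Borel space $S$ is $\Pi^1_1$-hard if for every Polish space $Z$ and every coanalytic $B\subseteq Z$ there is a Borel map $f\colon Z\to S$ with $f^{-1}(A)=B$. *)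

(* Defs.v *)
From HB Require Import structures.
From mathcomp Require Import all_boot all_order all_algebra.
From mathcomp Require Import all_classical all_reals all_analysis.

Set Implicit Arguments.
Unset Strict Implicit.
Unset Printing Implicit Defensive.

Import Order.TTheory GRing.Theory Num.Theory.
Import numFieldNormedType.Exports.

Local Open Scope classical_set_scope.
Local Open Scope ring_scope.

(** Descriptive set theory. *)

Definition separable (T : topologicalType) : Prop :=
  exists2 D : set T, countable D & dense D.

Definition is_metric (R : realType) (T : Type) (d : T -> T -> R) : Prop :=
  [/\ forall x y, 0 <= d x y,
      forall x y, d x y = 0 <-> x = y,
      forall x y, d x y = d y x
    & forall x y z, d x z <= d x y + d y z].

Definition metric_topology (R : realType) (T : topologicalType)
    (d : T -> T -> R) : Prop :=
  forall (x : T) (A : set T),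
    nbhs x A <-> exists2 e : R, 0 < e & [set y | d x y < e] `<=` A.

Definition metric_cauchy (R : realType) (T : Type) (d : T -> T -> R)
    (u : nat -> T) : Prop :=
  forall e : R, 0 < e -> exists N : nat,
    forall m n : nat, (N <= m)%N -> (N <= n)%N -> d (u m) (u n) < e.

Definition completely_metrizable (R : realType) (T : topologicalType) : Prop :=
  exists d : T -> T -> R,
    [/\ is_metric d, metric_topology d
      & forall u : nat -> T, metric_cauchy d u ->
          exists l : T, u @ \oo --> l].

(* A Polish space may be empty, which is why neither [ptopologicalType] nor
   [measurableType] (both pointed) is used here; accordingly sigma-algebras are
   handled as set systems. Metrics take values in the realType [R]. *)
Definition polish (R : realType) (T : topologicalType) : Prop :=
  separable T /\ completely_metrizable R T.

Definition analytic (R : realType) (Z : topologicalType) (B : set Z) : Prop :=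
  exists (Y : topologicalType) (g : Y -> Z),
    [/\ polish R Y, continuous g & range g = B].

Definition coanalytic (R : realType) (Z : topologicalType) (B : set Z) : Prop :=
  analytic R (~` B).

Definition borel (T : topologicalType) : set_system T := <<s @open T >>.

(* [FS] is the sigma-algebra of the standard Borel space [S]; standardness plays
   no role in the formula. *)
Definition Pi11_hard (R : realType) (S : Type) (FS : set_system S)
    (A : set S) : Prop :=
  forall (Z : topologicalType) (B : set Z), polish R Z -> coanalytic R B ->
    exists f : Z -> S,
      (forall V : set S, FS V -> borel (f @^-1` V)) /\ f @^-1` A = B.

(** Topological vector spaces. *)

Section tvs_notions.
Variables (R : realType) (E : preTopologicalLmodType R).

Definition is_norm (p : E -> R) : Prop :=
  [/\ forall x, 0 <= p x,
      forall x, p x = 0 -> x = 0,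
      forall (a : R) x, p (a *: x) = `|a| * p x
    & forall x y, p (x + y) <= p x + p y].

Definition normable : Prop :=
  exists p : E -> R, is_norm p /\ metric_topology (fun x y => p (x - y)).

(* Von Neumann boundedness: [B] is absorbed by every neighborhood of 0. *)
Definition tvs_bounded (B : set E) : Prop :=
  forall U : set E, nbhs (0 : E) U ->
    exists2 r : R, 0 < r & forall t : R, r < t -> B `<=` ( *:%R t) @` U.

(* As a set in [{family tvs_bounded, E -> R}], the type [strong_dual] is
   canonically equipped with the topology of uniform convergence on the bounded
   sets. *)
Definition strong_dual : set {family tvs_bounded, E -> R} :=
  [set f : E -> R | scalar f /\ continuous f].

Definition has_separable_dual : Prop := separable strong_dual.

End tvs_notions.

(** Closed vector subspaces, with the induced structures. *)

Record closedSubspace (R : realType) (E : preTopologicalLmodType R) :=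
  ClosedSubspace {
    subspace_set :> set E ;
    subspace_submod : submod_closed (mem subspace_set) ;
    subspace_closed : closed subspace_set
  }.

Section closed_subspace_structure.
Variables (R : realType) (E : preTopologicalLmodType R) (X : closedSubspace E).

Definition subspace_pred : {pred E} := mem (X : set E).

HB.instance Definition _ :=
  GRing.isSubmodClosed.Build R E subspace_pred (subspace_submod X).

Definition subspace_type : Type := {x : E | x \in subspace_pred}.

HB.instance Definition _ := SubChoice.on subspace_type.
HB.instance Definition _ := [SubChoice_isSubLmodule of subspace_type by <:].
HB.instance Definition _ := Topological.copy subspace_type
  (initial_topology (\val : subspace_type -> E)).

End closed_subspace_structure.

Definition effros (R : realType) (E : preTopologicalLmodType R) :
    set_system (closedSubspace E) :=
  <<s [set V | exists2 U : set E, open U &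
         V = [set X : closedSubspace E | (X : set E) `&` U !=set0]] >>.

(** The space C(R). *)

Definition CR (R : realType) : Type := continuousType R R.

Section CR_structure.
Variable R : realType.
Implicit Types f g : CR R.

HB.instance Definition _ := Choice.on (CR R).

(* The compact-open topology is that of uniform convergence on compact sets, see
   [compact_open_fam_compactP]. *)
HB.instance Definition _ := Topological.copy (CR R)
  (initial_topology (id : continuousType R R -> {compact-open, R -> R})).

Lemma CR_zero_cts : continuous (fun _ : R => 0 : R).
Proof. by move=> x; exact: cvg_cst. Qed.

Lemma CR_opp_cts f : continuous (fun x : R => - f x).
Proof. by move=> x; apply: cvgN; exact: cts_fun. Qed.

Lemma CR_add_cts f g : continuous (fun x : R => f x + g x).
Proof. by move=> x; apply: cvgD; exact: cts_fun. Qed.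

Lemma CR_scale_cts (a : R) f : continuous (fun x : R => a * f x).
Proof. by move=> x; apply: cvgM; [exact: cvg_cst|exact: cts_fun]. Qed.

Definition CR_zero : CR R := mkcts CR_zero_cts.
Definition CR_opp f : CR R := mkcts (@CR_opp_cts f).
Definition CR_add f g : CR R := mkcts (@CR_add_cts f g).
Definition CR_scale (a : R) f : CR R := mkcts (@CR_scale_cts a f).

Lemma CR_addA : associative CR_add.
Proof. by move=> f g h; apply/continuousEP => x; exact: addrA. Qed.

Lemma CR_addC : commutative CR_add.
Proof. by move=> f g; apply/continuousEP => x; exact: addrC. Qed.

Lemma CR_add0 : left_id CR_zero CR_add.
Proof. by move=> f; apply/continuousEP => x; exact: add0r. Qed.

Lemma CR_addN : left_inverse CR_zero CR_opp CR_add.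
Proof. by move=> f; apply/continuousEP => x; exact: addNr. Qed.

HB.instance Definition _ :=
  GRing.isZmodule.Build (CR R) CR_addA CR_addC CR_add0 CR_addN.

Lemma CR_scaleA (a b : R) f : CR_scale a (CR_scale b f) = CR_scale (a * b) f.
Proof. by apply/continuousEP => x; exact: mulrA. Qed.

Lemma CR_scale1 : left_id 1 CR_scale.
Proof. by move=> f; apply/continuousEP => x; exact: mul1r. Qed.

Lemma CR_scaleDr : right_distributive CR_scale +%R.
Proof. by move=> a f g; apply/continuousEP => x; exact: mulrDr. Qed.

Lemma CR_scaleDl f : {morph CR_scale^~ f : a b / a + b}.
Proof. by move=> a b; apply/continuousEP => x; exact: mulrDl. Qed.

HB.instance Definition _ := GRing.Zmodule_isLmodule.Build R (CR R)
  CR_scaleA CR_scale1 CR_scaleDr CR_scaleDl.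

End CR_structure.

Definition SF (R : realType) : Type := closedSubspace (CR R).

Definition SF_effros (R : realType) : set_system (SF R) := @effros R (CR R).

Definition SD_notB (R : realType) : set (SF R) :=
  [set X : SF R | has_separable_dual (subspace_type X)
                  /\ ~ normable (subspace_type X)].

(* Main.v *)
Require Import Defs.
From mathcomp Require Import all_boot all_order all_algebra.
From mathcomp Require Import all_classical all_reals all_analysis.
From mathcomp Require Import ring lra.

Set Implicit Arguments.
Unset Strict Implicit.
Unset Printing Implicit Defensive.

Import Order.TTheory GRing.Theory Num.Theory.
Import numFieldNormedType.Exports.

Local Open Scope classical_set_scope.
Local Open Scope ring_scope.

(** Let [B] be coanalytic in [Z], and write the complement of [B] as [range g]
    with [g] continuous on a Polish space. A Souslin scheme turns [g] into a
    family of trees [T z] on [nat] such that [T z] has an infinite branch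
    exactly when [z] is in [range g], and such that each condition
    [s \in T z] is Borel in [z]. It remains to attach to a tree [T], in a
    measurable way, a non-normable closed subspace of C(R) whose dual is
    separable exactly when [T] has no infinite branch.

    The nodes [s = (s_0, ..., s_(k-1))] of [T] are numbered by codes [c], and
    the space is the closed span of functions [e_c] with
      e_c(x) = w_s(x) cos(2 pi 4^c x)    for x >= 0,
      w_s(x) = x^+ exp(x * sum_i s_i (x - i)^+).
    On the negative half-line [e_c] is a tent of height 1 around -(c+1), so
    that the coefficient of [e_c] in [f] is simply f(-(c+1)). On each interval
    [n, n+1] there are points where the waves cos(2 pi 4^c x) have arbitrarily
    prescribed signs and modulus at least 1/2 ([wave_signs]). Hence, up to a
    factor 2 and a shift of n, the sup norm over [-n, n] of an element with
    coefficients x_s is the weighted l1 norm [sum_s |x_s| w_s(n)]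
    ([tree_space_coefs], [tree_space_tail]): the space is a Koethe echelon
    space of order one over the index set [T]. The weights are chosen so that:

    - along a branch of [T] the weights w_s(n) are bounded for each n. The
      functions of a branch then form a bounded set, on which evaluations at
      suitable points take all patterns of signs. A diagonal argument against
      any sequence of functionals shows that the dual is not separable
      ([branch_dual_not_separable]);

    - on a set of nodes with some unbounded coordinate s_j, the ratio
      w_s(m) / w_s(n) is unbounded for m > max(n, j) ([weight_ratio]). If [T]
      has no branch, then by Koenig's lemma every infinite set of nodes has an
      unbounded coordinate, and the weights satisfy the condition that
      characterizes Montel echelon spaces ([montel]). The series of
      coefficients therefore converges uniformly on bounded sets
      ([coef_tail]), and the countably many rational combinations of
      coefficient functionals are dense in the strong dual
      ([no_branch_dual_separable]).

    Finally, all sequences of length one are put into the trees: this creates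
    no new branch, and the ratios of weights along them show that no
    neighborhood of 0 is bounded ([tree_space_not_normable]). *)

(** * The compact-open topology of C(R) *)

Section CR_topology.
Variable R : realType.
Implicit Types f g h : CR R.

Definition bounded_on (n : nat) (f : R -> R) (M : R) : Prop :=
  forall x, `|x| <= n%:R -> `|f x| <= M.

Lemma CR_addE f g x : (f + g) x = f x + g x. Proof. by []. Qed.
Lemma CR_oppE f x : (- f) x = - f x. Proof. by []. Qed.
Lemma CR_scaleE a f x : (a *: f) x = a * f x. Proof. by []. Qed.
Lemma CR_sumE (I : Type) (r : seq I) (F : I -> CR R) x :
  (\sum_(i <- r) F i) x = \sum_(i <- r) F i x.
Proof. by elim/big_rec2: _ => // i y z _ <-. Qed.

Lemma bounded_on_le n m f M M' : (n <= m)%N -> M <= M' ->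
  bounded_on m f M -> bounded_on n f M'.
Proof.
move=> nm MM' fM x xn; apply: le_trans MM'; apply: fM.
by rewrite (le_trans xn)// ler_nat.
Qed.

(** For both directions neighborhoods are expressed as convergence of a filter
    to [f], because convergence is where the compact-open topology is known to
    agree, at a continuous function, with uniform convergence on compact
    sets. *)
Lemma CR_nbhsP f (A : set (CR R)) :
  nbhs f A <-> exists n : nat, exists2 e : R, 0 < e &
    [set g | bounded_on n (g - f) e] `<=` A.
Proof.
have cf : continuous (f : R -> R) by exact: cts_fun.
split.
  case=> [_ [[B oB <-]] /= Bf] BA.
  pose F : set_system (R -> R) := filter_from
    [set ne : nat * R | 0 < ne.2]
    (fun ne => [set g : R -> R | bounded_on ne.1 (fun x => g x - f x) ne.2]).
  have FF : Filter F.
    apply: filter_from_filter; first by exists (0%N, 1) => /=.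
    move=> [n e] [m d] /= e0 d0; exists (maxn n m, Num.min e d) => /=.
      by rewrite lt_min e0.
    move=> g /= H; split=> x hx /=.
      have /H : `|x| <= (maxn n m)%:R by rewrite (le_trans hx)// ler_nat leq_maxl.
      by rewrite le_min => /andP[].
    have /H : `|x| <= (maxn n m)%:R by rewrite (le_trans hx)// ler_nat leq_maxr.
    by rewrite le_min => /andP[].
  have FcvgF : {compact-open, F --> (f : R -> R)}.
    apply/compact_open_fam_compactP => //; apply/fam_cvgP => K cK P.
    move=> /uniform_nbhs[E [+ EP]]; rewrite -entourage_ballE => -[e /= e0 eE].
    have [M [_ /(_ (`|M| + 1))]] := compact_bounded cK.
    rewrite (le_lt_trans (ler_norm M)) ?ltrDl// => /(_ isT) KM.
    exists ((Num.Def.truncn (`|M| + 1)).+1, e / 2) => /=; first by rewrite divr_gt0.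
    move=> g gf; apply: EP => x Kx; apply: eE => /=.
    rewrite /ball /= distrC (le_lt_trans (gf _ _)) ?ltr_pdivrMr ?ltr_pMr ?ltr1n//.
    by rewrite (le_trans (KM _ Kx))// ltW// truncnS_gt.
  have [] := FcvgF B.
    by rewrite nbhsE; exists B.
  by move=> [n e] /= e0 neB; exists n, e => // g gf; apply: BA => /=; exact: neB.
case=> n [e e0 neA].
pose A' := [set g : R -> R |
  forall x, `[-n%:R, n%:R]%classic x -> `|g x - f x| < e].
have : nbhs (f : {compact-open, R -> R}) A'.
  have FF : Filter (nbhs (f : {compact-open, R -> R})) by exact: nbhs_filter.
  have /(compact_open_fam_compactP cf FF) : {compact-open,
    nbhs (f : {compact-open, R -> R}) --> (f : R -> R)} by [].
  apply.
  apply: (@fam_nbhs _ _ _ _ [set xy : R * R | `|xy.2 - xy.1| < e]) => //.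
    by rewrite -entourage_ballE; exists e => // -[x y]; rewrite /ball /= distrC.
  exact: segment_compact.
rewrite nbhsE => -[B [oB Bf] BA'].
exists ((fun g : CR R => g : R -> R) @^-1` B); split => //=; first by exists B.
move=> g Bg; apply: neA => x xn; apply/ltW/BA' => //=.
by rewrite in_itv/= -ler_norml.
Qed.

End CR_topology.

(** * Waves with prescribed signs *)

Section waves.
Variable R : realType.

Definition wave (c : nat) (x : R) : R := cos (pi *+ 2 * (4 ^+ c * x)).

Lemma cos_pi3 : cos (pi / 3) = 2^-1 :> R.
Proof.
have pi0 := pi_gt0 R.
set c := cos _; have c0 : 0 < c by apply: cos_gt0_pihalf; lra.
have : c ^+ 2 *+ 2 - 1 = - c.
  rewrite -cos_mulr2n (_ : _ *+ 2 = - (pi / 3) + pi); last by rewrite mulr2n; lra.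
  by rewrite cosDpi cosN.
rewrite mulr2n => e; have : (c + 1) * (2 * c - 1) = 0 by nra.
by move=> /eqP; rewrite mulf_eq0 => /orP[] /eqP; lra.
Qed.

Lemma cos_ge_half (u : R) : 0 <= u <= 6^-1 -> 2^-1 <= cos (pi *+ 2 * u).
Proof.
move=> /andP[u0 u6]; have pi0 := pi_gt0 R; rewrite -cos_pi3.
rewrite leNgt ltr_cos ?in_itv/= -?leNgt ?mulr2n; nra.
Qed.

(** [u c] is the number with base 4 digits [2 d_c, 2 d_(c+1), ...] after the
    point, the supremum of its truncations [S k c]. The bound 2/3 is the value
    obtained when all digits are 2. *)
Lemma digits_exist (d : nat -> bool) : exists2 u : nat -> R,
  forall c, 4 * u c = (d c).*2%:R + u c.+1 & forall c, 0 <= u c <= 2 / 3.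
Proof.
pose S := fix S k c : R := if k is k'.+1 then ((d c).*2%:R + S k' c.+1) / 4 else 0.
have d2 c : 0 <= ((d c).*2%:R : R) <= 2 by rewrite ler0n ler_nat; case: (d c).
have Sb k c : 0 <= S k c <= 2 / 3.
  elim: k c => [|k IH] c /=; first lra.
  by have := IH c.+1; have := d2 c; lra.
pose u c := sup [set S k c | k in setT].
have uS c : has_sup [set S k c | k in setT].
  split; first by exists (S 0%N c), 0%N.
  by exists (2 / 3) => _ [k _ <-]; have := Sb k c; lra.
have Su k c : S k c <= u c by apply: sup_upper_bound => //; exists k.
have us c (b : R) : (forall k, S k c <= b) -> u c <= b.
  by move=> H; apply: ge_sup; [exact: (uS c).1|move=> _ [k _ <-]].
exists u => c; last first.
  by rewrite (le_trans _ (Su 0%N c)) //=; apply: us => k; have := Sb k c; lra.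
apply/eqP; rewrite eq_le; apply/andP; split.
  rewrite mulrC -ler_pdivlMr//; apply: us => -[|k] /=.
    by have := d2 c; have := Su 0%N c.+1 => /=; lra.
  by have := Su k c.+1; lra.
rewrite -lerBrDl; apply: us => k.
by have := Su k.+1 c => /=; lra.
Qed.

(** Take for [x] the number [n] plus the base 4 expansion with digits
    [2 d_0, 2 d_1, ...]. Multiplication by [4 ^ c] shifts the digits, so
    modulo an integer [4 ^ c * x] is in [[0, 1/6]] if [d c] is false and in
    [[1/2, 2/3]] if it is true, where the wave is at least 1/2, respectively
    at most -1/2. *)
Lemma wave_signs (n : nat) (d : nat -> bool) : exists2 x : R,
  n%:R <= x <= n.+1%:R & forall c, 2^-1 <= (-1) ^+ (d c) * wave c x.
Proof.
have [u uE ub] := digits_exist d; exists (n%:R + u 0%N).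
  by have := ub 0%N; rewrite -natr1; lra.
move=> c; rewrite /wave.
have [m ->] : exists m : nat, 4 ^+ c * (n%:R + u 0%N) = u c + m%:R.
  elim: c => [|c [m IH]]; first by exists n; rewrite expr0; ring.
  exists (4 * m + (d c).*2)%N; rewrite exprS -mulrA IH mulrDr uE natrD natrM; ring.
rewrite mulrDr mulr_natr periodicn; last exact: cosD2pi.
have := uE c; rewrite -muln2 natrM => ec; have := ub c.+1; have := ub c.
case: (d c) ec => /= ec u1 u2; last by rewrite mul1r cos_ge_half//; lra.
rewrite expr1 mulN1r -[X in _ <= - cos X](subrK pi) cosDpi opprK.
rewrite [_ - pi](_ : _ = pi *+ 2 * (u c - 2^-1)); last by rewrite mulr2n; field.
by apply: cos_ge_half; lra.
Qed.

End waves.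

(** * The basis functions *)

Section basis.
Variable R : realType.
Implicit Types (s : seq nat) (x y : R).

(** At a given [x] only the coordinates [s_i] with [i < x] count, which keeps
    the growth bounded along a branch; and each coordinate counts as soon as
    [x] is large. *)
Definition growth s x : R :=
  \sum_(i < size s) (nth 0%N s i)%:R * Num.max 0 (x - i%:R).

Definition weight s x : R := Num.max 0 x * expR (x * growth s x).

(** The first term is a tent of height 1 at [- c.+1], which vanishes at the
    other negative integers and on the positive half-line; the second term
    vanishes on the negative half-line. *)
Definition basis_fun (c : nat) x : R :=
  Num.max 0 (1 - 2 * `|x + c.+1%:R|) + weight (CodeSeq.decode c) x * wave c x.

Lemma growth_le s x y : x <= y -> growth s x <= growth s y.
Proof.
move=> xy; apply: ler_sum => i _; apply: ler_wpM2l => //.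
by rewrite ge_max le_max lexx /= le_max lerB ?orbT.
Qed.

Lemma growth_ge0 s x : 0 <= growth s x.
Proof. by apply: sumr_ge0 => i _; rewrite mulr_ge0// le_max lexx. Qed.

Lemma growth_ge s j x : j%:R + 1 <= x -> (nth 0%N s j)%:R <= growth s x.
Proof.
move=> jx; have [js|js] := ltnP j (size s); last by rewrite nth_default// growth_ge0.
rewrite /growth (bigD1 (Ordinal js))//= -[leLHS]addr0 lerD//; last first.
  by apply: sumr_ge0 => i _; rewrite mulr_ge0// le_max lexx.
by rewrite -[leLHS]mulr1 ler_wpM2l// le_max; apply/orP; right; lra.
Qed.

Lemma weight_ge0 s x : 0 <= weight s x.
Proof. by rewrite mulr_ge0 ?expR_ge0// le_max lexx. Qed.

Lemma weight_le s x y : 0 <= x -> x <= y -> weight s x <= weight s y.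
Proof.
move=> x0 xy; have y0 := le_trans x0 xy.
rewrite /weight !max_r// ler_pM ?expR_ge0// ler_expR ler_pM ?growth_ge0//.
exact: growth_le.
Qed.

Lemma weight_nat_ge1 s n : 1 <= weight s n.+1%:R.
Proof.
rewrite /weight max_r// mulr_ege1 ?ler1n// -expR0 ler_expR.
by rewrite mulr_ge0// growth_ge0.
Qed.

Lemma weight_gt0 s n : 0 < weight s n.+1%:R.
Proof. by rewrite (lt_le_trans ltr01)// weight_nat_ge1. Qed.

Lemma weight_le0 s x : x <= 0 -> weight s x = 0.
Proof. by move=> x0; rewrite /weight max_l// mul0r. Qed.

Lemma basis_cts c : continuous (basis_fun c).
Proof.
have max0 (f : R -> R) : continuous f -> continuous (fun x => Num.max 0 (f x)).
  move=> cf x; apply: (@continuous_max _ _ (fun=> 0) f) => //; last exact: cf.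
  exact: cst_continuous.
move=> x; apply: cvgD.
  apply: (max0 (fun x => 1 - 2 * `|x + c.+1%:R|)) => {}x.
  apply: cvgB; first exact: cvg_cst.
  apply: cvgMr; apply: cvg_norm; apply: cvgD; [exact: cvg_id|exact: cvg_cst].
apply: cvgM; last first.
  apply: continuous_comp; last exact: continuous_cos.
  by apply: cvgMr; apply: cvgMr; exact: cvg_id.
apply: cvgM; first by apply: (max0 id) => {}x; exact: cvg_id.
apply: continuous_comp; last exact: continuous_expR.
apply: cvgM; first exact: cvg_id.
apply: continuous_big => [|i _ {}x]; first exact: add_continuous.
apply: cvgMr; apply: (max0 (fun x => x - i%:R)) => {}x.
by apply: cvgB; [exact: cvg_id|exact: cvg_cst].
Qed.

Definition basis (c : nat) : CR R := mkcts (@basis_cts c).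

Lemma basisE c x : 0 <= x ->
  basis c x = weight (CodeSeq.decode c) x * wave c x.
Proof.
move=> x0; rewrite /basis /= /mkcts /basis_fun max_l ?add0r//.
have : (1 : R) <= c.+1%:R by rewrite ler1n.
by rewrite ger0_norm ?addr_ge0//; lra.
Qed.

Lemma basis_node c c' : basis c (- c'.+1%:R) = (c == c')%:R.
Proof.
rewrite /basis /= /mkcts /basis_fun weight_le0 ?oppr_le0// mul0r addr0.
have [->|cc'] := eqVneq c c'; first by rewrite addNr normr0 mulr0 subr0 max_r.
rewrite max_l//=.
suff : (1 : R) <= `|- c'.+1%:R + c.+1%:R| by lra.
move: cc'; rewrite neq_ltn ler_normr => /orP[] cc'; apply/orP; [right|left].
  by have : (c.+1%:R + 1 : R) <= c'.+1%:R by [rewrite natr1 ler_nat]; lra.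
by have : (c'.+1%:R + 1 : R) <= c.+1%:R by [rewrite natr1 ler_nat]; lra.
Qed.

Lemma wave_le1 c x : `|wave c x| <= 1.
Proof. by rewrite ler_norml cos_geN1 cos_le1. Qed.

Lemma basis_bounded c n :
  bounded_on n.+1 (basis c) (weight (CodeSeq.decode c) n.+1%:R).
Proof.
move=> x; rewrite ler_norml => /andP[xn nx]; have [x0|x0] := leP 0 x.
  rewrite basisE// normrM ger0_norm ?weight_ge0//.
  have := wave_le1 c x; have := weight_le (CodeSeq.decode c) x0 nx.
  have := weight_ge0 (CodeSeq.decode c) x; nra.
apply: le_trans (weight_nat_ge1 _ n).
rewrite /basis /= /mkcts /basis_fun (weight_le0 _ (ltW x0)) mul0r addr0.
rewrite ger0_norm; last by rewrite le_max lexx.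
by rewrite ge_max ler01 gerBl mulr_ge0.
Qed.

End basis.

(** * The closed subspace attached to a tree *)

Section tree_space.
Variable R : realType.
Implicit Types (f g h : CR R) (T : set (seq nat)).

Definition node_weight (c n : nat) : R := weight (CodeSeq.decode c) n%:R.

(** The tents make these evaluations biorthogonal to the basis functions, see
    [basis_node]. *)
Definition coef f (c : nat) : R := f (- c.+1%:R).

Definition psum (N : nat) f : CR R := \sum_(c < N) coef f c *: basis R c.

(** As coefficients are evaluations, a finite linear combination of basis
    functions is an [f] that is equal to one of its own partial sums; this
    avoids any choice of a list of nodes or coefficients. *)
Definition tree_span T : set (CR R) :=
  [set f | (forall c, ~ T (CodeSeq.decode c) -> coef f c = 0) /\
           exists N, f = psum N f].

Lemma psum_linear N a f g : psum N (a *: f + g) = a *: psum N f + psum N g.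
Proof.
rewrite /psum scaler_sumr -big_split/=; apply: eq_bigr => c _.
by rewrite scalerA -scalerDl.
Qed.

Lemma coef_psum N f c : coef (psum N f) c = if (c < N)%N then coef f c else 0.
Proof.
rewrite /coef CR_sumE (eq_bigr (fun i : 'I_N =>
    if i == c :> nat then coef f i else 0)); last first.
  by move=> i _; rewrite CR_scaleE basis_node; case: eqP => _; rewrite ?mulr1 ?mulr0.
rewrite -big_mkcond/=; case: ltnP => cN; last first.
  by rewrite big_pred0// => i; apply: contraTF cN => /eqP <-; rewrite -ltnNge.
by rewrite (big_pred1 (Ordinal cN)).
Qed.

Lemma psum_widen N M f : f = psum N f -> (N <= M)%N -> f = psum M f.
Proof.
move=> fN NM; rewrite {1}fN /psum.
rewrite (big_ord_widen M (fun c : nat => coef f c *: basis R c) NM) big_mkcond/=.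
apply: eq_bigr => c _; case: ifPn => // cN.
by rewrite {1}fN coef_psum (negbTE cN) scale0r.
Qed.

Lemma tree_span_linear T a f g :
  tree_span T f -> tree_span T g -> tree_span T (a *: f + g).
Proof.
move=> [f0 [N fN]] [g0 [M gM]]; split=> [c cT|].
  by rewrite /coef CR_addE CR_scaleE -/(coef f c) -/(coef g c) f0// g0// mulr0 addr0.
exists (maxn N M); rewrite psum_linear.
by rewrite -(psum_widen fN (leq_maxl _ _)) -(psum_widen gM (leq_maxr _ _)).
Qed.

Lemma tree_span_basis T c : T (CodeSeq.decode c) -> tree_span T (basis R c).
Proof.
move=> cT; split=> [c' c'T|].
  by rewrite /coef basis_node; case: eqP c'T => // <-.
exists c.+1; rewrite /psum (bigD1 ord_max)//= big1 ?addr0.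
  by rewrite /coef basis_node eqxx scale1r.
move=> i /eqP ic; rewrite /coef basis_node.
case: eqP => [e|_]; last by rewrite scale0r.
by case: ic; apply: val_inj.
Qed.

Lemma closure_CRP (A : set (CR R)) f : closure A f <->
  forall n e, 0 < e -> exists2 g, A g & bounded_on n (g - f) e.
Proof.
split=> [Af n e e0|H B /CR_nbhsP[n [e e0 neB]]].
  have [|g [Ag fg]] := Af [set g | bounded_on n (g - f) e]; last by exists g.
  by apply/CR_nbhsP; exists n, e.
by have [g Ag gf] := H n e e0; exists g; split => //; exact: neB.
Qed.

Lemma bounded_on_linear n a f g M M' : bounded_on n f M -> bounded_on n g M' ->
  bounded_on n (a *: f + g) (`|a| * M + M').
Proof.
move=> fM gM x xn; rewrite CR_addE CR_scaleE (le_trans (ler_normD _ _))//.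
by rewrite normrM lerD ?ler_wpM2l ?fM ?gM.
Qed.

Lemma bounded_onD n f g M M' : bounded_on n f M -> bounded_on n g M' ->
  bounded_on n (f + g) (M + M').
Proof.
move=> fM gM x xn; rewrite CR_addE (le_trans (ler_normD _ _))//.
by rewrite lerD ?fM ?gM.
Qed.

Definition closed_span T : set (CR R) := closure (tree_span T).

Lemma closed_span_submod T : submod_closed (mem (closed_span T)).
Proof.
split.
  apply/mem_set/subset_closure; split => //; exists 0%N.
  by rewrite /psum big_ord0.
move=> a f g /set_mem/closure_CRP fT /set_mem/closure_CRP gT.
apply/mem_set/closure_CRP => n e e0.
have d0 : 0 < `|a| + 1 by rewrite ltr_wpDl.
have [f' f'T ff'] := fT n (e / 2 / (`|a| + 1)) ltac:(by rewrite !divr_gt0).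
have [g' g'T gg'] := gT n (e / 2) ltac:(by rewrite !divr_gt0).
exists (a *: f' + g'); first exact: tree_span_linear.
have -> : a *: f' + g' - (a *: f + g) = a *: (f' - f) + (g' - g).
  by rewrite scalerBr opprD addrACA.
apply: bounded_on_le (leqnn n) _ (bounded_on_linear a ff' gg').
rewrite [leRHS](splitr e) lerD2r mulrA ler_pdivrMr// mulrC.
by rewrite ler_wpM2l ?lerDl// ltW// divr_gt0.
Qed.

Definition tree_space T : SF R :=
  ClosedSubspace (closed_span_submod T) (@closed_closure _ _).

(** At a point of [[n, n+1]] where each wave has the sign of the corresponding
    coefficient, no cancellation takes place in [f]. *)
Lemma tree_span_coefs T f n N M : tree_span T f -> bounded_on n.+1 f M ->
  \sum_(c < N) `|coef f c| * node_weight c n <= 2 * M.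
Proof.
move=> [_ [N' fN']] fM.
have : \sum_(c < N) `|coef f c| * node_weight c n <=
    \sum_(c < maxn N N') `|coef f c| * node_weight c n.
  rewrite (big_ord_widen _ (fun c : nat =>
    `|coef f c| * node_weight c n) (leq_maxl N N')).
  rewrite big_mkcond/= ler_sum// => c _.
  by case: ifP => // _; rewrite mulr_ge0 ?weight_ge0.
move/le_trans; apply.
have fE := psum_widen fN' (leq_maxr N N').
have [x /andP[nx xn] wx] := @wave_signs R n (fun c => coef f c < 0).
have x0 : 0 <= x by rewrite (le_trans _ nx).
have : f x <= M.
  by rewrite (le_trans (ler_norm _))// fM// ger0_norm.
rewrite {1}fE CR_sumE -ler_pdivrMl//; apply: le_trans; rewrite mulr_sumr.
apply: ler_sum => c _; rewrite CR_scaleE basisE// /node_weight.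
have := wx c; have := weight_le (CodeSeq.decode c) (ler0n R n) nx.
have := weight_ge0 (CodeSeq.decode c) (n%:R : R).
set u := weight _ n%:R; set v := weight _ x; set w := wave _ _ => u0 uv.
have [c0|c0] := ltP (coef f c) 0.
  rewrite expr1 mulN1r ltr0_norm// => w2.
  have : 2^-1 * u <= v * - w by nra.
  by rewrite -(ler_nM2l c0); lra.
rewrite expr0 mul1r ger0_norm// => w2.
have : 2^-1 * u <= v * w by nra.
by move=> /(ler_wpM2l c0); lra.
Qed.

End tree_space.

(** * Comparison with a weighted l1 space *)

Section tree_space_estimates.
Variable R : realType.
Implicit Types (f g h : CR R) (T : set (seq nat)).

Lemma coef_le n c f M : (c < n)%N -> bounded_on n f M -> `|coef f c| <= M.
Proof. by move=> cn; apply; rewrite normrN ger0_norm// ler_nat. Qed.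

Lemma node_weight_ge0 c n : 0 <= node_weight R c n.
Proof. exact: weight_ge0. Qed.

Lemma psumE N f : psum N f = \sum_(0 <= c < N) coef f c *: basis R c.
Proof. by rewrite big_mkord. Qed.

Lemma tree_space_subr T f g :
  closed_span T f -> closed_span T g -> closed_span T (f - g).
Proof.
move=> fT gT; have [_ /(_ (-1) g f)] := closed_span_submod R T.
by rewrite scaleN1r addrC => /(_ (mem_set gT) (mem_set fT))/set_mem.
Qed.

Lemma tree_space_coef0 T f c :
  closed_span T f -> ~ T (CodeSeq.decode c) -> coef f c = 0.
Proof.
move=> /closure_CRP fT cT; apply/eqP; rewrite -normr_le0.
apply/ler_addgt0Pr => e e0; rewrite add0r.
have [g [g0 _] gf] := fT c.+1 e e0.
rewrite -[coef f c]subr0 -[X in _ - X](g0 c cT) distrC.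
exact: (coef_le (ltnSn c) gf).
Qed.

(** Only finitely many coefficients occur, and each of them is continuous in
    [f], so the estimate passes from the span to its closure. *)
Lemma tree_space_coefs T f n N M : closed_span T f -> bounded_on n.+1 f M ->
  \sum_(0 <= c < N) `|coef f c| * node_weight R c n <= 2 * M.
Proof.
move=> /closure_CRP fT fM; rewrite big_mkord; apply/ler_addgt0Pr => e e0.
set S := \sum_(c < N) node_weight R c n.
have S0 : 0 < 2 + S by rewrite ltr_wpDr// sumr_ge0// => c _; exact: node_weight_ge0.
have d0 : 0 < e / (2 + S) by rewrite divr_gt0.
(* The interval [-N, N] contains the nodes -(c+1) for all c < N. *)
have [g gT gf] := fT (maxn n.+1 N) _ d0; set d := e / (2 + S) in d0 gf *.
have gM : bounded_on n.+1 g (M + d).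
  rewrite -[g](subrK f) addrC; apply: bounded_onD => //.
  exact: bounded_on_le (leq_maxl _ _) (lexx _) gf.
have := tree_span_coefs N gT gM.
have -> : 2 * M + e = 2 * (M + d) + d * S by rewrite /d; field; rewrite gt_eqF.
move/(lerD (lexx (d * S))); rewrite [leRHS]addrC; apply: le_trans.
rewrite mulr_sumr -big_split/= ler_sum// => c _.
rewrite -mulrDl ler_wpM2r ?node_weight_ge0//.
rewrite -[coef f c](subrK (coef g c)) (le_trans (ler_normD _ _))// lerD2r distrC.
apply: (@coef_le N _ (g - f)) => //.
exact: bounded_on_le (leq_maxr _ _) (lexx _) gf.
Qed.

Lemma sum_basis_le n (x : R) f N N' : `|x| <= n.+1%:R ->
  `|\sum_(N <= c < N') coef f c * basis R c x| <=
  \sum_(N <= c < N') `|coef f c| * node_weight R c n.+1.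
Proof.
move=> xn; rewrite (le_trans (ler_norm_sum _ _ _))// ler_sum// => c _.
by rewrite normrM ler_wpM2l// basis_bounded.
Qed.

(** With [h = g - f] small and [g] in the span,
    [f - psum N f = - h + (g - psum N g) + psum N h]. The middle term is a
    finite sum and the last one is controlled by the coefficients of [h], so
    the coefficient estimate applied to [h] bounds the error independently of
    the length of [g]. *)
Lemma tree_space_tail T f n N t : closed_span T f ->
  (forall N', \sum_(N <= c < N') `|coef f c| * node_weight R c n.+1 <= t) ->
  bounded_on n.+1 (f - psum N f) t.
Proof.
move=> fT ft x xn; apply/ler_addgt0Pr => e e0.
have e3 : 0 < e / 3 by rewrite divr_gt0.
have /closure_CRP/(_ n.+2 _ e3)[g gT gf] := fT.
have gTX : closed_span T g by exact: subset_closure.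
have hT := tree_space_subr gTX fT.
have [_ [N0 /psum_widen gN0]] := gT.
have {N0 gN0} [N' NN' gN'] : exists2 N', (N <= N')%N & g = psum N' g.
  by exists (maxn N N0); [exact: leq_maxl|apply: gN0; exact: leq_maxr].
set h := g - f in gf hT.
have hs : \sum_(0 <= c < N') `|coef h c| * node_weight R c n.+1 <= 2 * (e / 3).
  exact: tree_space_coefs hT gf.
have hx : `|h x| <= e / 3 by apply: gf; rewrite (le_trans xn)// ler_nat.
have -> : (f - psum N f) x = - h x + ((g - psum N g) x + (psum N h) x).
  have -> : psum N h = - psum N f + psum N g.
    by rewrite /h -[g - f]addrC -[- f]scaleN1r psum_linear scaleN1r.
  by rewrite /h !(CR_addE, CR_oppE, CR_scaleE); ring.
have h1 := sum_basis_le h 0 N xn.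
have g1 := sum_basis_le g N N' xn.
have gE : (g - psum N g) x = \sum_(N <= c < N') coef g c * basis R c x.
  rewrite {1}gN' CR_addE CR_oppE !psumE !CR_sumE.
  rewrite (big_cat_nat _ NN')//= addrAC subrr add0r.
  by apply: eq_bigr => c _; rewrite CR_scaleE.
have hE : psum N h x = \sum_(0 <= c < N) coef h c * basis R c x.
  by rewrite psumE CR_sumE; apply: eq_bigr => c _; rewrite CR_scaleE.
rewrite -gE in g1; rewrite -hE in h1.
have gs : \sum_(N <= c < N') `|coef g c| * node_weight R c n.+1 <=
  \sum_(N <= c < N') `|coef f c| * node_weight R c n.+1 +
  \sum_(N <= c < N') `|coef h c| * node_weight R c n.+1.
  rewrite -big_split/= ler_sum// => c _.
  rewrite -mulrDl ler_wpM2r ?node_weight_ge0//.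
  by rewrite -[coef g c](subrK (coef f c)) (le_trans (ler_normD _ _))// addrC.
move: hs; rewrite (big_cat_nat _ NN')//= => hs.
have := ft N'; have := ler_normD (- h x) ((g - psum N g) x + psum N h x).
have := ler_normD ((g - psum N g) x) (psum N h x); rewrite normrN.
lra.
Qed.

End tree_space_estimates.

(** * Measurability for the Effros structure *)

Section effros_measurability.
Variable R : realType.

Lemma borel_bigcup (Z : topologicalType) (A : nat -> set Z) :
  (forall k, borel (A k)) -> borel (\bigcup_k A k).
Proof. by move=> bA; have [_ _] := @smallest_sigma_algebra Z setT open; exact. Qed.

Lemma borelC (Z : topologicalType) (A : set Z) : borel A -> borel (~` A).
Proof.
move=> bA; rewrite -setTD; have [_ + _] := @smallest_sigma_algebra Z setT open.
by apply.
Qed.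

Lemma borel0 (Z : topologicalType) : borel (@set0 Z).
Proof. by have [] := @smallest_sigma_algebra Z setT open. Qed.

Lemma borel_open (Z : topologicalType) (A : set Z) : open A -> borel A.
Proof. by move=> oA; apply: sub_gen_smallest. Qed.

Lemma borel_closed (Z : topologicalType) (A : set Z) : closed A -> borel A.
Proof.
move=> cA; rewrite -[A]setCK; apply: borelC; apply: borel_open.
exact: closed_openC.
Qed.

Lemma borel_cond (Z : topologicalType) (P : Prop) (A : set Z) :
  (P -> borel A) -> borel [set z | P /\ A z].
Proof.
have [p /(_ p)|np _] := pselect P.
  by congr borel; apply/seteqP; split => [z|z []].
by rewrite (_ : [set _ | _] = set0); [exact: borel0|apply/seteqP; split => [z []|]].
Qed.

Lemma borel_all (Z : topologicalType) (A : nat -> set Z) (l : seq nat) :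
  (forall k, borel (A k)) -> borel [set z | forall k, k \in l -> A k z].
Proof.
move=> bA; rewrite (_ : [set z | _] = ~` \bigcup_k [set z | k \in l /\ (~` A k) z]).
  by apply: borelC; apply: borel_bigcup => k; apply: borel_cond => _; exact: borelC.
apply/seteqP; split => [z zA [k _ [/zA]]//|z nz k kl].
by apply: contrapT => nA; apply: nz; exists k.
Qed.

(** Whether the span meets [U] depends on [T] only through the finite sets of
    nodes, coded by [k], that are contained in [T]. *)
Lemma tree_span_meets (T : set (seq nat)) (U : set (CR R)) :
  tree_span T `&` U !=set0 <-> exists k : nat,
  (exists f : CR R, [/\ U f, exists N, f = psum N f &
     forall c, c \notin CodeSeq.decode k -> coef f c = 0]) /\
  forall c, c \in CodeSeq.decode k -> T (CodeSeq.decode c).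
Proof.
split=> [[f [[f0 [N fN]] Uf]]|[k [[f [Uf fN f0]] kT]]]; last first.
  exists f; split => //; split => // c cT; apply: f0.
  by apply/negP => /kT.
exists (CodeSeq.code [seq c <- iota 0 N | `[< T (CodeSeq.decode c) >]]).
rewrite CodeSeq.codeK; split; last first.
  by move=> c; rewrite mem_filter => /andP[/asboolP].
exists f; split => //; first by exists N.
move=> c; rewrite mem_filter mem_iota add0n negb_and => /orP[/asboolPn/f0//|].
by rewrite leq0n/= => cN; rewrite fN coef_psum (negbTE cN).
Qed.

(** An open set meets a closure exactly when it meets the set itself, so the
    generators of the Effros structure have as preimages countable unions of
    finite intersections of the sets [[set z | Tz z s]]. *)
Lemma tree_space_borel (Z : topologicalType) (Tz : Z -> set (seq nat)) :
  (forall s, borel [set z | Tz z s]) ->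
  forall V, @SF_effros R V -> borel ((fun z => tree_space R (Tz z)) @^-1` V).
Proof.
move=> bT V; set F := fun z => _.
suff : @SF_effros R `<=` [set V | borel (F @^-1` V)] by apply.
apply: smallest_sub.
  split => /=.
  - by rewrite preimage_set0; exact: borel0.
  - by move=> A bA; rewrite setTD preimage_setC; exact: borelC.
  - by move=> A bA; rewrite preimage_bigcup; exact: borel_bigcup.
move=> _ [U oU ->] /=.
rewrite (_ : _ @^-1` _ = [set z | tree_span (Tz z) `&` U !=set0]); last first.
  apply/seteqP; split => z [f [fT Uf]].
    by have [|g [gT Ug]] := fT U; [exact: open_nbhs_nbhs|exists g].
  by exists f; split => //; exact: subset_closure.
under eq_set do rewrite (propext (tree_span_meets _ _)).
pose P k := exists f : CR R, [/\ U f, exists N, f = psum N f &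
     forall c, c \notin CodeSeq.decode k -> coef f c = 0].
rewrite (_ : [set z | _] = \bigcup_k [set z | P k /\
   [set z | forall c, c \in CodeSeq.decode k -> Tz z (CodeSeq.decode c)] z]).
  apply: borel_bigcup => k; apply: borel_cond => _.
  by apply: (borel_all _ (fun c => bT (CodeSeq.decode c))).
by apply/seteqP; split => [z [k kz]|z [k _ kz]]; exists k.
Qed.

End effros_measurability.

(** * Separability of strong duals *)

Section strong_dual_separability.
Variables (R : realType) (E : preTopologicalLmodType R).

Lemma tvs_boundedU (A B : set E) :
  tvs_bounded A -> tvs_bounded B -> tvs_bounded (A `|` B).
Proof.
move=> bA bB U U0; have [r r0 Ar] := bA U U0; have [q q0 Bq] := bB U U0.
exists (Num.max r q); first by rewrite lt_max r0.
by move=> t; rewrite gt_max => /andP[rt qt] x [/(Ar t rt)|/(Bq t qt)].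
Qed.

Lemma tvs_bounded0 : tvs_bounded (@set0 E).
Proof. by move=> U U0; exists 1 => // t _ x []. Qed.

(** The topology is a supremum over all bounded sets; one bounded set suffices
    because bounded sets are closed under union. *)
Lemma strong_dual_nbhs (psi : {family @tvs_bounded R E, E -> R})
    (A : set {family @tvs_bounded R E, E -> R}) :
  nbhs psi A -> exists2 B, tvs_bounded B & exists2 e : R, 0 < e &
    [set phi : E -> R | forall x, B x -> `|psi x - phi x| < e] `<=` A.
Proof.
pose F : set_system (E -> R) := filter_from
  [set Be : set E * R | tvs_bounded Be.1 /\ 0 < Be.2]
  (fun Be => [set phi : E -> R | forall x, Be.1 x -> `|psi x - phi x| < Be.2]).
have FF : Filter F.
  apply: filter_from_filter.
    by exists (set0, 1); split => //; exact: tvs_bounded0.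
  move=> [B e] [C d] /= [bB e0] [bC d0]; exists (B `|` C, Num.min e d) => /=.
    by rewrite lt_min e0; split => //; exact: tvs_boundedU.
  move=> phi /= H; split=> x Bx.
    by have := H x (or_introl Bx); rewrite lt_min => /andP[].
  by have := H x (or_intror Bx); rewrite lt_min => /andP[].
suff : {family @tvs_bounded R E, F --> (psi : E -> R)}.
  by move=> /(_ A)/[apply] -[[B e] /= [bB e0] BeA]; exists B => //; exists e.
apply/fam_cvgP => B bB P /uniform_nbhs[V [+ VP]].
rewrite -entourage_ballE => -[e /= e0 eV].
by exists (B, e) => // phi psiphi; apply: VP => x Bx; apply: eV; exact: psiphi.
Qed.

(** Density in terms of a sequence of functionals, which makes both the
    construction of a dense sequence and a diagonal argument direct. *)
Lemma has_separable_dualP : has_separable_dual E <->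
  exists2 phi : nat -> E -> R, (forall k, @strong_dual R E (phi k)) &
  forall psi B e, @strong_dual R E psi -> tvs_bounded B -> 0 < e ->
    exists k, forall x, B x -> `|psi x - phi k x| < e.
Proof.
split=> [[D /countable_injP[code cinj] dD]|[phi phiE phid]]; last first.
  exists (range (fun k => SigSub (mem_set (phiE k)) : set_type (@strong_dual R E))).
    exact: card_image_le.
  move=> O [psi Opsi] [W oW OW].
  have [|B bB [e e0 BeW]] := @strong_dual_nbhs (set_val psi) W.
    by apply: open_nbhs_nbhs; split => //; rewrite -OW in Opsi.
  have [k psik] := phid _ B e (set_valP psi) bB e0.
  exists (SigSub (mem_set (phiE k))); split; last by exists k.
  by rewrite -OW; exact: BeW.
have zeroE : @strong_dual R E (fun=> 0).
  split => [a x y /=|x]; first by rewrite mulr0 addr0.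
  exact: cvg_cst.
(* An enumeration of [D], padded with the zero functional. *)
have /choice[phi phiP] (k : nat) : exists f : E -> R, @strong_dual R E f /\
    forall d, D d -> code d = k -> set_val d = f :> (E -> R).
  have [[d Dd dk]|nD] := pselect (exists2 d, D d & code d = k); last first.
    by exists (fun=> 0); split => // d Dd dk; case: nD; exists d.
  exists (set_val d); split; first exact: set_valP.
  by move=> d' Dd' d'k; congr set_val; apply: cinj; rewrite ?inE// dk.
exists phi => [k|psi B e psiE bB e0]; first by have [] := phiP k.
pose p : set_type (@strong_dual R E) := SigSub (mem_set psiE).
pose O : set (set_type (@strong_dual R E)) :=
  [set q | forall x, B x -> `|psi x - (set_val q : E -> R) x| < e].
have pO : nbhs p O.
  have : nbhs (psi : {family @tvs_bounded R E, E -> R})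
      [set q : E -> R | forall x, B x ->
        [set xy : R * R | `|xy.1 - xy.2| < e] (psi x, q x)].
    by apply: fam_nbhs => //; rewrite -entourage_ballE; exists e.
  by move=> /(@initial_continuous _ _
    (set_val : set_type (@strong_dual R E) -> _) p).
have [||q [/interior_subset Oq Dq]] := dD (interior O).
- by exists p.
- exact: open_interior.
exists (code q) => x Bx; have [_ /(_ q Dq erefl) <-] := phiP (code q).
exact: Oq.
Qed.

End strong_dual_separability.

(** * Neighborhoods, bounded sets and functionals in closed subspaces of C(R) *)

Section subspace_facts.
Variables (R : realType) (X : SF R).
Let E := subspace_type X.

(** Fixes the type of the inclusion, so that the operations of C(R) and those
    of the subspace are compared by conversion. *)
Definition incl (f : E) : CR R := \val f.

Lemma inclD (f g : E) : incl (f + g) = incl f + incl g. Proof. by []. Qed.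
Lemma inclZ (a : R) (f : E) : incl (a *: f) = a *: incl f. Proof. by []. Qed.
Lemma incl0 : incl 0 = 0. Proof. by []. Qed.
Lemma inclN (f : E) : incl (- f) = - incl f. Proof. by []. Qed.

Lemma subspace_nbhsP (x : E) (A : set E) :
  nbhs x A <-> exists n : nat, exists2 e : R, 0 < e &
    [set y : E | bounded_on n (incl y - incl x) e] `<=` A.
Proof.
split.
  move=> [_ [[B oB <-] /= Bx] BA].
  have /CR_nbhsP[n [e e0 neB]] : nbhs (incl x) B by exact: open_nbhs_nbhs.
  by exists n, e => // y yx; apply: BA; exact: neB.
move=> [n [e e0 neA]].
have : nbhs (incl x) [set g : CR R | bounded_on n (g - incl x) e].
  by apply/CR_nbhsP; exists n, e.
move=> H; apply: (filterS neA).
exact: (@initial_continuous _ _ incl x _ H).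
Qed.

Lemma subspace_nbhs0P (A : set E) :
  nbhs (0 : E) A <-> exists n : nat, exists2 e : R, 0 < e &
    [set f : E | bounded_on n (incl f) e] `<=` A.
Proof.
split=> [/subspace_nbhsP|] [n [e e0 neA]].
  by exists n, e => // f fn; apply: neA; rewrite /mkset incl0 subr0.
by apply/subspace_nbhsP; exists n, e => // f; rewrite /mkset incl0 subr0; exact: neA.
Qed.

Lemma subspace_boundedP (B : set E) :
  tvs_bounded B <-> forall n, exists M, forall f, B f -> bounded_on n (incl f) M.
Proof.
split=> [bB n|bB U /subspace_nbhs0P[n [e e0 neU]]].
  have [|r r0 rB] := bB [set f : E | bounded_on n (incl f) 1].
    by apply/subspace_nbhs0P; exists n, 1.
  have rr : r < r + 1 by rewrite ltrDl.
  exists (r + 1) => f /(rB _ rr)[u u1 <-] x xn.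
  rewrite inclZ CR_scaleE normrM gtr0_norm ?addr_gt0// ler_piMr ?u1//.
  by rewrite addr_ge0 ?ltW.
have [M MB] := bB n.
exists (`|M| / e + 1); first by rewrite ltr_wpDl ?divr_ge0 ?(ltW e0).
move=> t Mt f Bf.
have t0 : 0 < t by rewrite (le_lt_trans _ Mt)// addr_ge0 ?divr_ge0 ?(ltW e0).
exists (t^-1 *: f); last by rewrite scalerA divff ?scale1r ?gt_eqF.
apply: neU  => x xn; rewrite inclZ CR_scaleE normrM.
rewrite gtr0_norm ?invr_gt0// ler_pdivrMl//.
rewrite (le_trans (MB f Bf x xn))// (le_trans (ler_norm M))// -ler_pdivrMr//.
by rewrite (le_trans _ (ltW Mt))// lerDl.
Qed.

Lemma evaluation_dual (x : R) :
  strong_dual ((fun f : E => incl f x) : {family @tvs_bounded R E, E -> R}).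
Proof.
split=> [a f g|f /= A /nbhs_ballP[e /= e0 eA]]; first by [].
rewrite /= nbhs_simpl/=; apply/subspace_nbhsP.
have [n xn] : exists n : nat, `|x| <= n%:R.
  by exists (Num.Def.truncn `|x|).+1; rewrite ltW// truncnS_gt.
exists n, (e / 2) => [|g gf]; first by rewrite divr_gt0.
apply: eA; rewrite /ball /= distrC (le_lt_trans (gf x xn))//.
by rewrite ltr_pdivrMr// ltr_pMr// ltr1n.
Qed.

Lemma dual_linear_combination (a : R) (phi psi : E -> R) :
  @strong_dual R E phi -> @strong_dual R E psi ->
  @strong_dual R E (fun f => a * phi f + psi f).
Proof.
move=> [phil phic] [psil psic]; split=> [b f g|f /=].
  by rewrite phil psil; ring.
have FF : Filter (nbhs f) := nbhs_filter f.
apply: (@cvgD _ _ _ _ FF (fun g => a * phi g) psi (a * phi f) (psi f));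
  last exact: psic.
exact: (@cvgMr _ _ _ FF phi a (phi f) (phic f)).
Qed.

Lemma dual_bounded_on (phi : E -> R) : @strong_dual R E phi ->
  exists n, exists2 C : R, 0 < C &
  forall f M, bounded_on n.+1 (incl f) M -> `|phi f| <= C * M.
Proof.
move=> [phil phic].
have phi0 : phi 0 = 0.
  by have := phil (-1) 0 0; rewrite scaler0 addr0 mulN1r addNr.
have phiZ a f : phi (a *: f) = a * phi f.
  by have := phil a f 0; rewrite addr0 phi0 addr0.
have : nbhs (0 : E) (phi @^-1` ball (phi 0) 1) by apply: phic; exact: nbhsx_ballx.
move=> /subspace_nbhs0P[n [e e0 neb]]; exists n, (2 / e); first by rewrite divr_gt0.
have H f M : 0 < M -> bounded_on n (incl f) M -> `|phi f| <= e^-1 * M.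
  move=> M0 fM; have : ball (phi 0) 1 (phi ((e / M) *: f)).
    apply: neb  => x xn; rewrite inclZ CR_scaleE normrM.
    rewrite gtr0_norm ?divr_gt0// mulrAC ler_pdivrMr// ler_wpM2l ?(ltW e0)//.
    exact: fM.
  rewrite /ball /= phi0 sub0r normrN phiZ normrM gtr0_norm ?divr_gt0// => /ltW.
  by rewrite mulrAC ler_pdivrMr// mul1r mulrC -ler_pdivlMr// mulrC.
move=> f M fM; have M0 : 0 <= M.
  by apply: le_trans (fM 0 _) => //; rewrite normr0.
move: M0; rewrite le_eqVlt => /orP[/eqP M0|M0]; last first.
  have := H f M M0 (bounded_on_le (leqnSn n) (lexx M) fM).
  have : 0 < e^-1 * M by rewrite mulr_gt0 ?invr_gt0.
  by lra.
rewrite -M0 mulr0; apply/ler_addgt0Pr => d d0; rewrite add0r.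
have := H f (e * d) (mulr_gt0 e0 d0); rewrite mulKf ?gt_eqF//; apply.
apply: bounded_on_le fM; first exact: leqnSn.
by rewrite -M0 ltW// mulr_gt0.
Qed.

End subspace_facts.

(** * Infinite sets of nodes in a tree without branches *)

Section koenig.

Definition prefix_closed (T : set (seq nat)) : Prop :=
  forall s k, T s -> T (take k s).

Definition has_branch (T : set (seq nat)) : Prop :=
  exists b : nat -> nat, forall k, T (mkseq b k).

(** Bounded coordinates make the tree of initial segments of [A] finitely
    branching: if infinitely many elements of [A] extend [u], then infinitely
    many extend one of the finitely many successors of [u]. *)
Lemma koenig (T A : set (seq nat)) : prefix_closed T -> A `<=` T ->
  infinite_set A -> (forall j, exists b, forall s, A s -> (nth 0%N s j <= b)%N) ->
  has_branch T.
Proof.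
move=> pT AT Ainf Ab.
pose ext u := A `&` [set s | prefix u s].
have step u : exists v, infinite_set (ext u) -> infinite_set (ext (rcons u v)).
  apply: contrapT => /forallNP fin; have [b bA] := Ab (size u).
  have finv v : finite_set (ext (rcons u v)).
    by apply: contrapT => vinf; apply: (fin v).
  apply: (fin 0%N) => uinf; exfalso; apply: uinf.
  apply: (@sub_finite_set _ _ ([set u] `|` \bigcup_(v in `I_b.+1) ext (rcons u v))).
    move=> s [As /prefixP[[|v t] sE]]; [left|right]; first by rewrite sE cats0.
    exists v; first by have := bA s As; rewrite sE nth_cat ltnn subnn.
    by split => //=; rewrite sE -cat_rcons prefix_prefix.
  rewrite finite_setU; split; first exact: finite_set1.
  by apply: bigcup_finite => // v _; exact: finv.
have [v vP] := choice step.
pose U k := iter k (fun u => rcons u (v u)) [::].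
have UE k : mkseq (fun k => v (U k)) k = U k.
  by elim: k => // k IH; rewrite mkseqS IH.
have Uinf k : infinite_set (ext (U k)).
  elim: k => [|k IH]; last exact: vP.
  have -> : ext (U 0%N) = A; last by [].
  by apply/seteqP; split => [s []//|s As]; split => //; exact: prefix0s.
exists (fun k => v (U k)) => k; rewrite UE.
have /infinite_setN0[s [As /prefixP[t sE]]] := Uinf k.
by have := pT s (size (U k)) (AT s As); rewrite sE take_size_cat.
Qed.

End koenig.

Section montel.
Variable R : realType.

(** Passing from [n.+1] to [m] gains at least one factor [expR g], where
    [g >= s_j] is the growth at [m]; the factor [n.+1] on the right is the
    linear factor of the weight. *)
Lemma weight_ratio s j n m : (n.+1 < m)%N -> (j < m)%N ->
  (1 + (nth 0%N s j)%:R) * weight s (n.+1%:R : R) <= n.+1%:R * weight s m%:R.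
Proof.
move=> nm jm; rewrite /weight !max_r// mulrCA ler_wpM2l//.
set g := growth s m%:R; have g0 : 0 <= g by exact: growth_ge0.
have jg : (nth 0%N s j)%:R <= g by apply: growth_ge; rewrite natr1 ler_nat.
have m1 : (1 : R) <= m%:R by rewrite ler1n (leq_trans _ jm).
apply: (@le_trans _ _ (expR g * expR (n.+1%:R * g))).
  apply: ler_pM => //; rewrite ?expR_ge0 ?addr_ge0//.
    by apply: le_trans (expR_ge1Dx g); rewrite lerD2l.
  by rewrite ler_expR ler_wpM2l// growth_le// ler_nat ltnW.
rewrite -expRD -[leLHS]mul1r ler_pM ?expR_ge0// ler_expR.
by rewrite -{1}[g]mul1r -mulrDl ler_wpM2r// nat1r ler_nat.
Qed.

(** The nodes that violate the conclusion have all ratios of weights bounded,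
    hence all coordinates bounded; by Koenig's lemma there are only finitely
    many of them. *)
Lemma montel T n (K : nat -> R) : prefix_closed T -> ~ has_branch T ->
  exists N, forall c, (N <= c)%N -> T (CodeSeq.decode c) ->
    exists m, K m * node_weight R c n.+1 <= node_weight R c m.
Proof.
move=> pT nT.
pose A := [set s | T s /\ forall m, weight s m%:R < K m * weight s n.+1%:R].
have [/finite_seqP[l Al]|Ainf] := pselect (finite_set A).
  exists (\max_(s <- l) CodeSeq.code s).+1 => c lc cT.
  apply: contrapT => /forallNP cK.
  have : A (CodeSeq.decode c).
    by split => // m; rewrite ltNge; apply/negP; exact: cK.
  rewrite Al => /= cl; move: lc; rewrite ltnNge -[c]CodeSeq.decodeK.
  by rewrite (leq_bigmax_seq _ cl).
case: nT; apply: (koenig pT _ Ainf) => [s []//|j].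
pose m := maxn n.+2 j.+1.
exists (Num.Def.truncn (n.+1%:R * K m)) => s [_ /(_ m) sm].
have := weight_ratio s (leq_maxl _ _ : n.+1 < m)%N (leq_maxr _ _ : j < m)%N.
move: sm; rewrite -(ltr_pM2l (ltr0Sn R n)) => sm /le_lt_trans/(_ sm).
rewrite [ltRHS]mulrA (ltr_pM2r (weight_gt0 R s n))// => sj.
have := truncnS_gt (n.+1%:R * K m); rewrite -ltnS -(ltr_nat R); lra.
Qed.

End montel.

(** * Tree spaces are not normable; a branch makes the dual non-separable *)

Section tree_space_tvs.
Variables (R : realType) (T : set (seq nat)).
Let E := subspace_type (tree_space R T).

Lemma incl_closed_span (f : E) : closed_span T (incl f).
Proof. exact: set_mem (valP f). Qed.

Lemma node_exists c : exists f : E,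
  T (CodeSeq.decode c) -> incl f = basis R c.
Proof.
have [cT|nT] := pselect (T (CodeSeq.decode c)); last by exists 0.
have bT : basis R c \in subspace_pred (tree_space R T).
  exact/mem_set/subset_closure/tree_span_basis.
by exists (exist _ (basis R c) bT).
Qed.

(** The basis function [c] as a vector of the subspace, a junk value when its
    node is not in [T]; the coefficient is then zero anyway. *)
Definition node c : E := proj1_sig (cid (node_exists c)).

Lemma incl_node c : T (CodeSeq.decode c) -> incl (node c) = basis R c.
Proof. exact: (proj2_sig (cid (node_exists c))). Qed.

(** If the unit ball of a norm contained the functions bounded by [e] on
    [[- n.+1, n.+1]], every seminorm would be dominated by the supremum over
    that interval, and the ratios of weights at [n.+2] and [n.+1] would be
    bounded over the nodes [[:: k]]. *)
Lemma tree_space_not_normable : (forall k, T [:: k]) -> ~ normable E.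
Proof.
move=> T1 [p [[p0 _ pZ _] pE]].
have p0f (f : E) : p (0 - f) = p f.
  by rewrite sub0r -scaleN1r pZ normrN1 mul1r.
have [n [e e0 ep]] : exists n : nat, exists2 e : R, 0 < e &
    forall f : E, bounded_on n.+1 (incl f) e -> p f < 1.
  have : nbhs (0 : E) [set f | p f < 1].
    by apply/pE; exists 1 => // f; rewrite /= p0f.
  move=> /subspace_nbhs0P[n [e e0 neA]]; exists n, e => // f fe.
  by apply: neA; apply: bounded_on_le fe => //; exact: leqnSn.
have [d d0 dp] : exists2 d : R, 0 < d &
    forall f : E, p f < d -> bounded_on n.+3 (incl f) 1.
  have : nbhs (0 : E) [set f | bounded_on n.+3 (incl f) 1].
    by apply/subspace_nbhs0P; exists n.+3, 1.
  move=> /pE[d d0 dA]; exists d => // f fd; apply: (dA f).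
  by rewrite /= p0f.
have key k : d * e * (1 + k%:R) <= 2 * n.+1%:R.
  pose c := CodeSeq.code [:: k].
  have cT : T (CodeSeq.decode c) by rewrite CodeSeq.codeK; exact: T1.
  have w0 : 0 < node_weight R c n.+1 by exact: weight_gt0.
  pose a := d * (e / node_weight R c n.+1).
  have a0 : 0 < a by rewrite mulr_gt0 ?divr_gt0.
  have : bounded_on n.+3 (incl (a *: node c)) 1.
    apply: dp; rewrite -scalerA pZ gtr0_norm// -[ltRHS]mulr1 ltr_pM2l//.
    apply: ep => x xn; rewrite inclZ CR_scaleE incl_node// normrM.
    rewrite gtr0_norm ?divr_gt0// mulrAC ler_pdivrMr// ler_wpM2l ?(ltW e0)//.
    exact: basis_bounded.
  move=> /(tree_space_coefs c.+1 (@incl_closed_span (a *: node c))).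
  rewrite big_nat_recr//.
  set S := \sum_(0 <= i < c) _.
  have S0 : 0 <= S by apply: sumr_ge0 => i _; rewrite mulr_ge0 ?node_weight_ge0.
  have -> : coef (incl (a *: node c)) c = a.
    by rewrite inclZ /coef CR_scaleE incl_node// basis_node eqxx mulr1.
  rewrite gtr0_norm//= mulr1 => aw.
  have := weight_ratio R [:: k] (ltnSn n.+1) (ltn0Sn n.+1).
  rewrite /= -[[:: k]]CodeSeq.codeK -/c -!/(node_weight R c _).
  rewrite -ler_pdivlMr// => kw.
  have aw2 : a * node_weight R c n.+2 <= 2 by lra.
  apply: (le_trans (ler_wpM2l (ltW (mulr_gt0 d0 e0)) kw)).
  have -> : d * e * (n.+1%:R * weight (CodeSeq.decode c) n.+2%:R /
      node_weight R c n.+1) = n.+1%:R * (a * node_weight R c n.+2).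
    by rewrite /a /node_weight; ring.
  by rewrite mulrC ler_wpM2r//.
have := key (Num.Def.truncn (2 * n.+1%:R / (d * e))).+1.
have := truncnS_gt (2 * n.+1%:R / (d * e)).
rewrite ltr_pdivrMr ?mulr_gt0// mulrC mulrDr mulr1.
by have := mulr_gt0 d0 e0; lra.
Qed.

Lemma growth_mkseq (b : nat -> nat) k n :
  growth (mkseq b k) (n%:R : R) <= \sum_(i < n) (b i)%:R * n%:R.
Proof.
rewrite /growth size_mkseq.
have -> : \sum_(i < k) (nth 0%N (mkseq b k) i)%:R * Num.max 0 (n%:R - i%:R) =
    \sum_(i < k) (b i)%:R * Num.max 0 (n%:R - i%:R) :> R.
  by apply: eq_bigr => i _; rewrite nth_mkseq.
elim: k => [|k IH]; first by rewrite big_ord0 sumr_ge0// => i _; rewrite mulr_ge0.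
have [kn|nk] := ltnP k n; last first.
  by rewrite big_ord_recr/= max_l ?mulr0 ?addr0// subr_le0 ler_nat.
rewrite (big_ord_widen n (fun i : nat => (b i)%:R * Num.max 0 (n%:R - i%:R)) kn).
rewrite big_mkcond/= ler_sum// => i _; case: ifP => _; last by rewrite mulr_ge0.
by rewrite ler_wpM2l// ge_max gerBl !ler0n.
Qed.

(** Against a sequence [phi] of functionals, the signs are chosen so that the
    evaluation at [x] differs from [phi k] by at least 1/2 at the [k]-th
    function of the branch; these functions form a bounded set. *)
Lemma branch_dual_not_separable : has_branch T -> ~ has_separable_dual E.
Proof.
move=> [b bT] /has_separable_dualP[phi phiE phid].
pose c k := CodeSeq.code (mkseq b k).
have cT k : T (CodeSeq.decode (c k)) by rewrite CodeSeq.codeK.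
have bB : tvs_bounded (range (fun k => node (c k))).
  apply/subspace_boundedP => n.
  exists (n.+1%:R * expR (n.+1%:R * \sum_(i < n.+1) (b i)%:R * n.+1%:R)).
  move=> _ [k _ <-]; rewrite incl_node//.
  apply: bounded_on_le (leqnSn n) _ (@basis_bounded _ _ _).
  rewrite CodeSeq.codeK /weight max_r// ler_wpM2l// ler_expR ler_wpM2l//.
  exact: growth_mkseq.
(* The node of the branch with code [i] is recovered from its length. *)
pose d i := let k := size (CodeSeq.decode i) in 0 <= phi k (node (c k)).
have [x /andP[x1 x2] wx] := @wave_signs R 1 d.
have x0 : 0 <= x by rewrite (le_trans _ x1).
have [k] := phid _ _ (2^-1) (evaluation_dual (tree_space R T) x) bB ltac:(by []).
move=> /(_ (node (c k)))-/(_ (ex_intro2 _ _ k I erefl)).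
rewrite incl_node// basisE//.
have := wx (c k); rewrite /d CodeSeq.codeK size_mkseq.
have : 1 <= weight (mkseq b k) x.
  exact: le_trans (weight_nat_ge1 R _ 0) (weight_le _ (ler0n R 1) x1).
set w := weight _ _; set v := wave _ _; set y := phi _ _ => w1.
rewrite ltr_norml => vy /andP[yl yu]; move: vy.
have [y0|y0] := leP 0 y.
  by rewrite expr1 mulN1r; nra.
by rewrite expr0 mul1r; nra.
Qed.

End tree_space_tvs.

(** * Without branches the dual is separable *)

Section tree_space_dual.
Variables (R : realType) (T : set (seq nat)).
Let E := subspace_type (tree_space R T).

Lemma geometric_sum_le2 M : \sum_(0 <= m < M) (2 ^+ m)^-1 <= 2 :> R.
Proof.
suff -> : \sum_(0 <= m < M) (2 ^+ m)^-1 = 2 - 2 / 2 ^+ M :> R.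
  by rewrite gerBl divr_ge0// exprn_ge0.
elim: M => [|M IH]; first by rewrite big_geq// expr0 divr1 subrr.
by rewrite big_nat_recr//= IH exprS; field; rewrite expf_neq0.
Qed.

(** Let [K m] bound the elements of [B] on [[- m.+1, m.+1]], so that the sum of
    [|coef f c| * node_weight c m] is at most [2 * K m]. By [montel], for large
    [c] the weight at [n.+1] is at most [node_weight c m / q m] for some [m]
    depending on [c]. Summing this bound over all [m] at once replaces the
    unknown choice of [m] by a geometric series of total at most [eta]. *)
Lemma coef_tail (B : set E) n (eta : R) : prefix_closed T -> ~ has_branch T ->
  tvs_bounded B -> 0 < eta -> exists N, forall f N', B f ->
    \sum_(N <= c < N') `|coef (incl f) c| * node_weight R c n.+1 <= eta.
Proof.
move=> pT nT /subspace_boundedP bB eta0.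
have /choice[K KB] m : exists K : R, 0 < K /\
    forall f, B f -> bounded_on m.+1 (incl f) K.
  have [M MB] := bB m.+1; exists (`|M| + 1); rewrite ltr_wpDl//; split => // f Bf.
  apply: bounded_on_le (leqnn _) _ (MB f Bf).
  by rewrite (le_trans (ler_norm M))// lerDl.
have K0 m : 0 < K m by have [] := KB m.
pose q m := 2 ^+ m * K m * 4 / eta.
have [N HN] := montel n q pT nT.
have /choice[mu muP] (c : nat) : exists m : nat, (N <= c)%N ->
    T (CodeSeq.decode c) -> q m * node_weight R c n.+1 <= node_weight R c m.
  have [[Nc cT]|ncT] := pselect ((N <= c)%N /\ T (CodeSeq.decode c)).
    by have [m mP] := HN c Nc cT; exists m.
  by exists 0%N => Nc cT; case: ncT.
exists N => f N' Bf.
pose M := (\max_(c < N') mu c).+1.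
have q0 m : 0 < q m by rewrite divr_gt0// !mulr_gt0// exprn_gt0.
apply: (@le_trans _ _ (\sum_(N <= c < N') \sum_(0 <= m < M)
    (q m)^-1 * (`|coef (incl f) c| * node_weight R c m))).
  apply: ler_sum_nat => c /andP[Nc cN'].
  have nn m : 0 <= (q m)^-1 * (`|coef (incl f) c| * node_weight R c m).
    by rewrite mulr_ge0 ?invr_ge0 ?(ltW (q0 m))// mulr_ge0// node_weight_ge0.
  have [cT|ncT] := pselect (T (CodeSeq.decode c)); last first.
    rewrite (tree_space_coef0 (@incl_closed_span _ _ f) ncT) normr0 mul0r.
    by apply: sumr_ge0 => m _; rewrite mul0r mulr0.
  have muM : (mu c < M)%N by rewrite ltnS (leq_bigmax (Ordinal cN')).
  rewrite (bigD1_seq (mu c)) ?mem_index_iota ?iota_uniq//=.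
  rewrite -[leLHS]addr0 lerD//; last by rewrite sumr_ge0.
  rewrite [leRHS]mulrCA ler_wpM2l// -ler_pdivrMl ?invr_gt0// invrK.
  exact: muP.
rewrite exchange_big/=.
apply: (@le_trans _ _ (\sum_(0 <= m < M) eta / 2 * (2 ^+ m)^-1)); last first.
  by rewrite -mulr_sumr; have := geometric_sum_le2 M; nra.
apply: ler_sum => m _; rewrite -mulr_sumr.
have : \sum_(N <= c < N') `|coef (incl f) c| * node_weight R c m <= 2 * K m.
  have [_ /(_ f Bf) fK] := KB m.
  have := tree_space_coefs (maxn N N') (@incl_closed_span _ _ f) fK.
  apply: le_trans; rewrite (big_cat_nat _ (leq_maxl N N'))//=.
  rewrite -[leLHS]add0r lerD//.
    by rewrite sumr_ge0// => c _; rewrite mulr_ge0// node_weight_ge0.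
  by have [//|N'N] := leqP N N'; rewrite !big_geq// ltnW.
have qi0 : 0 <= (q m)^-1 by rewrite invr_ge0 ltW.
move=> /(ler_wpM2l qi0)/le_trans; apply.
suff -> : (q m)^-1 * (2 * K m) = eta / 2 * (2 ^+ m)^-1 by [].
by rewrite /q; field; rewrite !gt_eqF// exprn_gt0.
Qed.

Definition node_evaluations (l : seq (nat * rat)) (f : E) : R :=
  \sum_(p <- l) ratr p.2 * coef (incl f) p.1.

Lemma node_evaluations_dual l : @strong_dual R E (node_evaluations l).
Proof.
elim: l => [|[c a] l IH].
  rewrite (_ : node_evaluations [::] = fun=> 0).
    split => [a x y /=|x]; first by rewrite mulr0 addr0.
    exact: (@cvg_cst _ _ _ _ (nbhs_filter x)).
  by apply/funext => f; rewrite /node_evaluations big_nil.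
have := dual_linear_combination (ratr a)
  (evaluation_dual (tree_space R T) (- c.+1%:R)) IH.
by congr (strong_dual _); apply/funext => f; rewrite /node_evaluations big_cons.
Qed.

(** A functional [psi] is approximated on [B] first by its restriction to
    finitely many coefficients, with error controlled by [coef_tail], then by
    replacing the values [psi (node c)] by rationals. *)
Lemma no_branch_dual_separable :
  prefix_closed T -> ~ has_branch T -> has_separable_dual E.
Proof.
move=> pT nT; apply/has_separable_dualP.
exists (fun k => node_evaluations (odflt [::] (unpickle k)))
  => [k|psi B e psiE bB e0].
  exact: node_evaluations_dual.
have [n [C C0 psiC]] := dual_bounded_on psiE.
have eta0 : 0 < e / 2 / C by rewrite !divr_gt0.
have [N tailN] := coef_tail n pT nT bB eta0.
have [K KB] : exists K, forall f, B f -> bounded_on N (incl f) K.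
  by move/subspace_boundedP : bB; exact.
pose K' := `|K| * N%:R + 1; have K'0 : 0 < K' by rewrite ltr_wpDl// mulr_ge0.
have /choice[r rP] (c : nat) : exists r : rat,
    `|psi (node R T c) - ratr r| <= e / 2 / K'.
  have [|r rI] := @rat_in_itvoo R (psi (node R T c) - e / 2 / K') (psi (node R T c)).
    by rewrite ltrBlDr ltrDl !divr_gt0.
  exists r; move: rI; rewrite in_itv/= => /andP[]; rewrite ler_norml; lra.
exists (pickle [seq (c, r c) | c <- iota 0 N]) => f Bf.
rewrite pickleK/= /node_evaluations big_map -(subn0 N) -/(index_iota 0 N) /=.
have [psil _] := psiE.
have psi0 : psi 0 = 0.
  by have := psil (-1) 0 0; rewrite scaler0 addr0 mulN1r addNr.
pose s : E := \sum_(0 <= c < N) coef (incl f) c *: node R T c.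
have psis : psi s = \sum_(0 <= c < N) coef (incl f) c * psi (node R T c).
  by rewrite /s; elim/big_rec2 : _ => // c x y _ <-; rewrite psil.
have incls : incl s = psum N (incl f).
  rewrite /s psumE; elim/big_rec2 : _ => // c x y _ <-; rewrite inclD inclZ.
  have [cT|ncT] := pselect (T (CodeSeq.decode c)); first by rewrite incl_node.
  by rewrite (tree_space_coef0 (@incl_closed_span _ _ f) ncT) !scale0r.
have d1 : `|psi (f - s)| <= e / 2.
  have : bounded_on n.+1 (incl (f - s)) (e / 2 / C).
    rewrite inclD inclN incls; apply: tree_space_tail (@incl_closed_span _ _ f) _.
    by move=> N'; exact: tailN.
  by move/psiC; rewrite mulrC divfK ?gt_eqF.
have psiB : psi f = psi (f - s) + psi s.
  by rewrite -[psi (f - s)]mul1r -psil scale1r subrK.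
have d2 : `|psi s - \sum_(0 <= c < N) ratr (r c) * coef (incl f) c| < e / 2.
  rewrite psis -sumrB/=.
  apply: (@le_lt_trans _ _ (\sum_(0 <= c < N) `|K| * (e / 2 / K'))).
    rewrite (le_trans (ler_norm_sum _ _ _))//.
    apply: ler_sum_nat => c /andP[_ cN].
    rewrite [ratr _ * _]mulrC -mulrBr normrM ler_pM//.
    by rewrite (le_trans _ (ler_norm K))// (coef_le cN (KB f Bf)).
  rewrite sumr_const_nat subn0 -[ltLHS]mulr_natr.
  have -> : `|K| * (e / 2 / K') * N%:R = e / 2 * (`|K| * N%:R / K') by ring.
  by rewrite gtr_pMr ?divr_gt0// ltr_pdivrMr// mul1r /K' ltrDl.
rewrite psiB -addrA (le_lt_trans (ler_normD _ _))//; lra.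
Qed.

End tree_space_dual.

(** * From analytic sets to trees *)

Section souslin.
Variable R : realType.

Lemma exists_inv_lt (e : R) : 0 < e -> exists i : nat, i.+1%:R^-1 < e.
Proof.
move=> e0; exists (Num.Def.truncn e^-1).
by rewrite invf_plt ?posrE// truncnS_gt.
Qed.

Variables (Y Z : topologicalType) (g : Y -> Z).
Variables (D : set Y) (code : Y -> nat) (d : Y -> Y -> R) (dZ : Z -> Z -> R).
Hypotheses (cg : continuous g) (dD : dense D).
Hypothesis code_inj : {in D &, injective code}.
Hypotheses (md : is_metric d) (td : metric_topology d).
Hypothesis complete_d : forall u : nat -> Y, metric_cauchy d u ->
  exists l : Y, u @ \oo --> l.
Hypotheses (mdZ : is_metric dZ) (tdZ : metric_topology dZ).

(** The coordinates of [s] are read as codes of points of [D]; a coordinate that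
    codes no point gives an empty cell, so that [D] and [Y] may be empty. *)
Definition cell (s : seq nat) : set Y :=
  [set y | forall i, (i < size s)%N -> exists a,
    [/\ D a, code a = nth 0%N s i & d a y < i.+1%:R^-1]].

(** Nodes of length at most one are added by force: this does not affect
    branches, and these nodes make the associated space non-normable. The
    closure makes membership of a node a closed condition on [z]. *)
Definition souslin_tree (z : Z) : set (seq nat) :=
  [set s | (size s <= 1)%N \/ closure (g @` cell s) z].

Lemma cell_take s k : cell s `<=` cell (take k s).
Proof.
move=> y ys i; rewrite size_take_min leq_min => /andP[ik /ys[a aP]].
by exists a; rewrite nth_take.
Qed.

Lemma souslin_tree_prefix z : prefix_closed (souslin_tree z).
Proof.
move=> s k [s1|sz]; [left|right].
  by rewrite (leq_trans _ s1)// size_take_min geq_minr.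
move: sz; apply: closureS => _ [y ys <-]; exists y => //; exact: cell_take.
Qed.

Lemma souslin_tree_borel s : borel [set z | souslin_tree z s].
Proof.
have [s1|s1] := leqP (size s) 1.
  rewrite (_ : [set z | _] = setT); first by apply: borel_open; exact: openT.
  by apply/seteqP; split => // z _; left.
rewrite (_ : [set z | _] = closure (g @` cell s)).
  by apply: borel_closed; exact: closed_closure.
apply/seteqP; split => [z [|//]|z sz]; last by right.
by rewrite leqNgt s1.
Qed.

Lemma cell_diam s i y y' : (i < size s)%N -> cell s y -> cell s y' ->
  d y y' < 2 * i.+1%:R^-1.
Proof.
move=> si ys y's; have [_ _ dC dT] := md.
have [a [Da ai ay]] := ys i si; have [a' [Da' a'i ay']] := y's i si.
have aa' : a = a' by apply: code_inj; rewrite ?inE// ai a'i.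
have := dT y a y'; rewrite (dC y a) aa' => /le_lt_trans; apply.
by rewrite mulr_natl mulr2n ltrD// -aa'.
Qed.

Lemma souslin_branch y : has_branch (souslin_tree (g y)).
Proof.
have /choice[a aP] i : exists a, D a /\ d a y < i.+1%:R^-1.
  have yi : nbhs y [set a | d y a < i.+1%:R^-1].
    by apply/td; exists (i.+1%:R^-1); rewrite ?invr_gt0.
  have [||a [/interior_subset ya Da]] :=
    dD (O := interior [set a | d y a < i.+1%:R^-1]).
  - by exists y.
  - exact: open_interior.
  by exists a; split => //; have [_ _ -> _] := md.
exists (fun i => code (a i)) => k; right; apply: subset_closure; exists y => //.
move=> i; rewrite size_mkseq => ik; exists (a i); rewrite nth_mkseq//.
by have [] := aP i.
Qed.

(** The cells along a branch are nonempty with diameters tending to 0, so they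
    shrink to a point [y], by completeness; by continuity their images shrink
    to [g y], and [z] is in the closure of each image. *)
Lemma branch_souslin z : has_branch (souslin_tree z) -> range g z.
Proof.
move=> [b bz]; pose N k := cell (mkseq b k.+2).
have {bz}bz k : closure (g @` N k) z.
  by have [|//] := bz k.+2; rewrite size_mkseq.
have NS k l : (k <= l)%N -> N l `<=` N k.
  move=> kl; rewrite /N (_ : mkseq b k.+2 = take k.+2 (mkseq b l.+2)).
    exact: cell_take.
  by rewrite -map_take take_iota (minn_idPl _).
have Nd k y y' : N k y -> N k y' -> d y y' < 2 * k.+1%:R^-1.
  by apply: cell_diam; rewrite size_mkseq.
have /choice[p pN] k : exists y, N k y.
  by have [_ [[y Ny _] _]] := bz k setT filterT; exists y.
have [d0 dE dC dT] := md; have [dZ0 dZE dZC dZT] := mdZ.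
have small (e : R) : 0 < e -> exists k, 2 * k.+1%:R^-1 < e.
  move=> e0; have [k ke] := exists_inv_lt (divr_gt0 e0 (ltr0Sn R 1)).
  by exists k; rewrite mulrC -ltr_pdivlMr.
have [y py] : exists y : Y, p @ \oo --> y.
  apply: (complete_d (u := p)) => e /small[k ke]; exists k => m n km kn.
  by apply: lt_trans ke; apply: Nd; [exact: NS (pN m)|exact: NS (pN n)].
exists y => //; apply/esym/dZE; apply/eqP; rewrite eq_le dZ0 andbT.
apply/ler_addgt0Pr => r r0; rewrite add0r.
have : nbhs y (g @^-1` [set z' | dZ (g y) z' < r / 2]).
  by apply: cg; apply/tdZ; exists (r / 2); rewrite ?divr_gt0.
move=> /td[e e0 eg].
have [k ke] := small (e / 2) ltac:(by rewrite divr_gt0).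
have [m [km yp]] : exists m, (k <= m)%N /\ d y (p m) < e / 2.
  have : nbhs y [set q | d y q < e / 2].
    by apply/td; exists (e / 2); rewrite ?divr_gt0.
  move=> /py[m _ mP]; exists (maxn k m); rewrite leq_maxl; split => //.
  by apply: mP => /=; exact: leq_maxr.
have : nbhs z [set z' | dZ z z' < r / 2].
  by apply/tdZ; exists (r / 2); rewrite ?divr_gt0.
move=> /(bz k)[_ [[q Nq <-] zq]].
have : d y q < e.
  have := lt_trans (Nd k _ _ (NS _ _ km _ (pN m)) Nq) ke.
  by have := dT y (p m) q; lra.
move=> /eg /= gyq; have := dZT z (g q) (g y); rewrite (dZC (g q)).
rewrite /= in zq; lra.
Qed.

End souslin.

Theorem theorem4p37 (R : realType) : Pi11_hard R (@SF_effros R) (@SD_notB R).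
Proof.
move=> Z B [_ [dZ [mdZ tdZ _]]] [Y [g [[[D cD dD] [d [md td cd]]] cg gB]]].
have /countable_injP[code code_inj] := cD.
pose T := souslin_tree g D code d.
exists (fun z => tree_space R (T z)); split.
  exact: tree_space_borel (fun s => souslin_tree_borel g D code d s).
apply/seteqP; split => [z [sepz _]|z Bz].
  apply: contrapT => nBz; have : range g z by rewrite gB.
  move=> [y _ yz]; apply: branch_dual_not_separable sepz; rewrite -yz.
  exact: souslin_branch.
split; last by apply: tree_space_not_normable => k; left.
apply: no_branch_dual_separable; first exact: souslin_tree_prefix.
move=> /(branch_souslin cg code_inj md td cd mdZ tdZ); rewrite gB.
by apply.
Qed.
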